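(* Let $m>1$ be an integer and $s=2m+2$. Let $(\xi_n)_{n\ge 1}$ be a sequence of independent identically distributed random variables taking the values $0,1,\dots,s,s+1$ with probabilities $p_0,p_1,\dots,p_s,p_{s+1}$ respectively, where $p_i\ge 0$, $p_i<1$, $\sum_{i=0}^{s+1}p_i=1$, and let $\xi=\sum_{n=1}^{\infty}s^{-n}\xi_n$, with characteristic function $f_\xi(t)=\mathbb{E}\,e^{it\xi}$ and $L_\xi=\limsup_{|t|\to\infty}|f_\xi(t)|$. Put $$u=(p_0+p_s-p_{\frac s2})+(p_1+p_{s+1}+p_{s-1})\cos\frac{2\pi}{s}+\sum_{j=2}^{m}(p_j+p_{s-j})\cos\frac{\pi j}{m+1},$$ $$v=(p_1+p_{s+1}-p_{s-1})\sin\frac{\pi}{m+1}+\sum_{j=2}^{m}(p_j-p_{s-j})\sin\frac{\pi j}{m+1}.$$ If $u\ne 0$ or $v\ne 0$, then $L_\xi\ge|f_\xi(2\pi)|>0$, and hence the distribution of $\xi$ is singular. On the other hand, if $u=0=v$, then $|f_\xi(2\pi)|=0$.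
   Context: A random variable has a singular distribution if there is a Borel set of Lebesgue measure zero to which it belongs with probability $1$. *)

(* Defs.v *)
From HB Require Import structures.
From mathcomp Require Export all_boot all_order all_algebra finmap.
From mathcomp Require Export all_classical all_reals all_analysis.
From mathcomp Require Export complex.

#[export] Set Implicit Arguments.
#[export] Unset Strict Implicit.
#[export] Unset Printing Implicit Defensive.

Export Order.TTheory GRing.Theory Num.Theory.
Export numFieldNormedType.Exports.

Local Open Scope classical_set_scope.
Local Open Scope ring_scope.

Section Probability.
Context {d : measure_display} {T : measurableType d} {R : realType}.
Variable P : probability T R.

Definition independent_RVs (X : nat -> {RV P >-> R}) : Prop :=
  forall (J : {fset nat}) (B : nat -> set R),
    (forall j, measurable (B j)) ->
    P (\bigcap_(j in [set` J]) (X j @^-1` B j)) =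
    (\prod_(j <- J) P (X j @^-1` B j))%E.

(* E[exp(i t X)], written through its real and imaginary parts, which are
   expectations of bounded random variables and hence finite. *)
Definition charfun (X : {RV P >-> R}) (t : R) : R[i] :=
  Complex (fine 'E_P[fun w => cos (t * X w)])
          (fine 'E_P[fun w => sin (t * X w)]).

Definition charfun_limsup (X : {RV P >-> R}) : \bar R :=
  limf_esup (fun t : R => (Normc.normc (charfun X t))%:E)
    (filter_from setT (fun M : R => [set t : R | M < `|t|])).

(* Atomic laws are not excluded. *)
Definition singular_distribution (X : {RV P >-> R}) : Prop :=
  exists B : set R,
    [/\ measurable B, lebesgue_measure B = 0%E & distribution P X B = 1%E].

End Probability.

(* Main.v *)
(* With [g] the characteristic function of one digit, [f t] is the product of
   the [g (t s^-n)] over [n >= 1]. As [g] is 1 on the integer multiples of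
   [2 pi], [f (2 pi s^k q) = f (2 pi q)] for natural numbers [k] and [q];
   taking [q = 1] bounds the limsup from below. In [f (2 pi)] the first factor is
   [u + i v], and the others form [f (2 pi / s)], whose real part is positive
   because [2 pi xi / s < pi / 2] almost surely.

   Singularity needs neither the zero-one law nor the Riemann-Lebesgue lemma.
   Put [c = f (2 pi) != 0]. Then
   [f (2 pi (s^k - 1)) = conj (prod_(n <= k) g (2 pi s^-n)) f (2 pi (1 - s^-k))]
   tends to [|c|^2], so that averages of [exp (2 i pi s^(L k) xi)] over
   [k < N], with [L] and [N] large, are close to [c] in quadratic mean under
   [P], whereas the averages of [exp (2 i pi s^(L k) x)] are close to 0 under
   Lebesgue measure, by orthogonality. By Chebyshev and Borel-Cantelli, the set
   of [x] at which infinitely many suitable averages are large is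
   Lebesgue-negligible and has full measure for the law of [xi]. *)
Require Import Defs.
From mathcomp Require Import measurable_realfun ring lra zify.

Local Open Scope classical_set_scope.
Local Open Scope ring_scope.

(** * The complex exponential of a real angle *)

Section cis.
Context {R : realType}.
Implicit Types x y : R.

Definition cis x : R[i] := Complex (cos x) (sin x).

Lemma cis0 : cis 0 = 1.
Proof. by rewrite /cis cos0 sin0. Qed.

Lemma cisD x y : cis (x + y) = cis x * cis y.
Proof. rewrite /cis cosD sinD; simpc; congr Complex; exact: addrC. Qed.

Lemma cis_sum (I : Type) (r : seq I) (F : I -> R) :
  cis (\sum_(i <- r) F i) = \prod_(i <- r) cis (F i).
Proof. exact: (big_morph _ cisD cis0). Qed.

Lemma cisD2pi x n : cis (x + 2 * pi * n%:R) = cis x.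
Proof.
have -> : 2 * pi * n%:R = (pi *+ 2) *+ n :> R.
  by rewrite -[RHS]mulr_natr mulr_natl.
by rewrite /cis (periodicn (@cosD2pi R)) (periodicn (@sinD2pi R)).
Qed.

Lemma Complex_sum (I : Type) (r : seq I) (A B : I -> R) :
  \sum_(i <- r) Complex (A i) (B i) =
  Complex (\sum_(i <- r) A i) (\sum_(i <- r) B i).
Proof.
by elim/big_rec3 : _ => // i a b z _ ->; simpc.
Qed.

End cis.

(** * Characteristic function of one digit, and finite products of its values *)

Section digit_cf.
Context {R : realType} (N : nat) (p : nat -> R).
Hypothesis p_ge0 : forall i, (i < N)%N -> 0 <= p i.
Hypothesis p_sum : \sum_(i < N) p i = 1.

Definition digit_cf (t : R) : R[i] :=
  \sum_(i < N) Complex (p i) 0 * cis (t * i%:R).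

Lemma digit_cfE t : digit_cf t =
  Complex (\sum_(i < N) p i * cos (t * i%:R)) (\sum_(i < N) p i * sin (t * i%:R)).
Proof.
rewrite -Complex_sum; apply: eq_bigr => i _.
by rewrite /cis; simpc.
Qed.

Lemma digit_cfD2pi t n : digit_cf (t + 2 * pi * n%:R) = digit_cf t.
Proof.
apply: eq_bigr => i _; congr (_ * _).
by rewrite mulrDl -mulrA -natrM cisD2pi.
Qed.

Lemma digit_cf2pi n : digit_cf (2 * pi * n%:R) = 1.
Proof.
rewrite -[_ * _]add0r digit_cfD2pi digit_cfE.
under eq_bigr do rewrite mul0r cos0 mulr1.
under [X in Complex _ X]eq_bigr do rewrite mul0r sin0 mulr0.
by rewrite p_sum big1.
Qed.

Lemma digit_cfN t : digit_cf (- t) = conjc (digit_cf t).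
Proof.
rewrite !digit_cfE /=; congr Complex; last rewrite -sumrN.
  by apply: eq_bigr => i _; rewrite mulNr cosN.
by apply: eq_bigr => i _; rewrite mulNr sinN mulrN.
Qed.

(** Distributing the product over the sums gives one term for each digit string [a]: this is the
    characteristic function, at 1, of a sum of independent digits weighted by the [w j]. *)
Lemma prod_digit_cf n (w : nat -> R) :
  \prod_(j < n) digit_cf (w j) =
  \sum_(a : {ffun 'I_n -> 'I_N})
    Complex (\prod_(j < n) p (a j)) 0 * cis (\sum_(j < n) w j * (a j)%:R).
Proof.
rewrite /digit_cf bigA_distr_bigA; apply: eq_bigr => a _.
rewrite big_split -cis_sum /=; congr (_ * _).
by rewrite -[RHS]/((\prod_(j < n) p (a j))%:C)%C rmorph_prod.
Qed.

Lemma sum_prod_digits n :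
  \sum_(a : {ffun 'I_n -> 'I_N}) \prod_(j < n) p (a j) = 1.
Proof.
rewrite -(bigA_distr_bigA (fun (_ : 'I_n) (i : 'I_N) => p i)).
by rewrite big1// => j _.
Qed.

Lemma prod_digits_ge0 n (a : {ffun 'I_n -> 'I_N}) : 0 <= \prod_(j < n) p (a j).
Proof. by apply: prodr_ge0 => j _; exact: p_ge0. Qed.

Lemma prod_digit_cfE n (w : nat -> R) :
  \prod_(j < n) digit_cf (w j) =
  Complex
   (\sum_(a : {ffun 'I_n -> 'I_N})
      (\prod_(j < n) p (a j)) * cos (\sum_(j < n) w j * (a j)%:R))
   (\sum_(a : {ffun 'I_n -> 'I_N})
      (\prod_(j < n) p (a j)) * sin (\sum_(j < n) w j * (a j)%:R)).
Proof.
rewrite prod_digit_cf -Complex_sum; apply: eq_bigr => a _.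
by rewrite /cis; simpc.
Qed.

(** The real part is a convex combination of cosines of angles in [[0, x]], as no digit exceeds
    [N.-1], and [cos] decreases on [[0, pi]]. *)
Lemma Re_prod_digit_cf_ge n (w : nat -> R) (x : R) :
  (forall j, 0 <= w j) -> x <= pi ->
  \sum_(j < n) w j * N.-1%:R <= x ->
  cos x <= complex.Re (\prod_(j < n) digit_cf (w j)).
Proof.
move=> w0 xpi wx; rewrite prod_digit_cfE /=.
rewrite -[leLHS]mul1r -[X in X * _](sum_prod_digits n).
rewrite mulr_suml; apply: ler_sum => a _.
apply: ler_wpM2l; first exact: prod_digits_ge0.
have S0 : 0 <= \sum_(j < n) w j * (a j)%:R.
  by apply: sumr_ge0 => j _; rewrite mulr_ge0.
have Sx : \sum_(j < n) w j * (a j)%:R <= x.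
  apply: le_trans wx; apply: ler_sum => j _; apply: ler_wpM2l => //.
  by rewrite ler_nat; case: (a j) => k /=; case: (N).
(* [ltr_cos] compares strictly, so the case of equality is set apart. *)
have [->//|nx] := eqVneq (\sum_(j < n) w j * (a j)%:R) x.
have Spi := le_trans Sx xpi; have x0 := le_trans S0 Sx.
by rewrite ltW// ltr_cos ?in_itv/= ?S0 ?x0 ?Spi// lt_neqAle nx.
Qed.

End digit_cf.

(** * The factor [u + i v] *)

Section digit_cf_first_factor.
Context {R : realType}.

(** The reflection of [j] into [s - j] pairs the indices [2..m] with [m+2..2m]; the six remaining
    ones are 0, 1, the centre [m+1], [s-1], [s] and [s+1]. *)
Lemma sum_symmetric_split (F : nat -> R) (m s : nat) :
  (1 < m)%N -> s = (2 * m + 2)%N ->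
  \sum_(i < s + 2) F i =
    F 0%N + F s + F m.+1 + (F 1%N + F (s + 1)%N + F (s - 1)%N)
    + \sum_(2 <= j < m.+1) (F j + F (s - j)%N).
Proof.
move=> m1 sE; rewrite -(big_mkord xpredT F) big_split /=.
have -> : \sum_(2 <= j < m.+1) F (s - j)%N = \sum_(m.+2 <= i < (2 * m).+1) F i.
  rewrite [RHS]big_nat_rev /=.
  (* The lower bound is rewritten as [2 + m] for [big_addn] to shift by [m]. *)
  rewrite -[RHS]/(\sum_(2 + m <= i < (2 * m).+1) F (m.+2 + (2 * m).+1 - i.+1)%N).
  rewrite [RHS]big_addn (_ : ((2 * m).+1 - m = m.+1)%N); last lia.
  apply: eq_big_nat => j jm; congr F; lia.
rewrite (@big_cat_nat _ _ _ 2)//=; last lia.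
rewrite (@big_cat_nat _ _ _ m.+1 2)//=; [|lia|lia].
rewrite (@big_cat_nat _ _ _ m.+2 m.+1)//=; [|lia].
rewrite (@big_cat_nat _ _ _ (2 * m).+1 m.+2)//=; [|lia|lia].
rewrite big_nat1 (_ : (s + 2 = (2 * m).+4)%N); last lia.
have -> : \sum_(0 <= i < 2) F i = F 0%N + F 1%N.
  by rewrite !big_nat_recr//= big_geq// add0r.
have tri k : \sum_(k <= i < k.+3) F i = F k + F k.+1 + F k.+2.
  by rewrite !big_nat_recr /= ?big_geq ?add0r//; lia.
have -> : F (s - 1)%N = F (2 * m).+1 by congr F; lia.
have -> : F s = F (2 * m).+2 by congr F; lia.
have -> : F (s + 1)%N = F (2 * m).+3 by congr F; lia.
by rewrite tri; ring.
Qed.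

(** At the angle [2 pi / s = pi / (m + 1)] the digits [j] and [s - j] have conjugate exponentials, 0
    and [s] give 1, [s / 2] gives -1, and [s + 1] gives the same as 1. *)
Lemma digit_cf_uv (m s : nat) (p : nat -> R) :
  (1 < m)%N -> s = (2 * m + 2)%N ->
  digit_cf (s + 2) p (2 * pi / s%:R) =
  Complex
   ((p 0%N + p s - p (s %/ 2)%N)
      + (p 1%N + p (s + 1)%N + p (s - 1)%N) * cos (2 * pi / s%:R)
      + \sum_(2 <= j < m.+1) (p j + p (s - j)%N) * cos (pi * j%:R / (m + 1)%:R))
   ((p 1%N + p (s + 1)%N - p (s - 1)%N) * sin (pi / (m + 1)%:R)
      + \sum_(2 <= j < m.+1) (p j - p (s - j)%N) * sin (pi * j%:R / (m + 1)%:R)).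
Proof.
move=> m1 sE.
have m0 : (m + 1)%:R != 0 :> R by rewrite pnatr_eq0; lia.
have angle : 2 * pi / s%:R = pi / (m + 1)%:R :> R.
  have -> : s%:R = 2 * (m + 1)%:R :> R by rewrite -natrM; congr (_%:R); lia.
  by field.
have ms : (s %/ 2 = m.+1)%N by rewrite sE; lia.
pose th : R := pi / (m + 1)%:R.
have thj j : pi * j%:R / (m + 1)%:R = th * j%:R by rewrite mulrAC.
have th_half : th * m.+1%:R = pi by rewrite /th -[m.+1]addn1 divfK.
have thN j : (j <= s)%N -> th * (s - j)%:R = - (th * j%:R) + 2 * pi * 1%:R.
  move=> js; rewrite natrB// mulrBr addrC; congr (_ + _).
  have -> : s%:R = 2 * m.+1%:R :> R by rewrite -natrM; congr (_%:R); lia.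
  by rewrite mulrCA th_half mulr1.
have cis_s j : (j <= s)%N -> cis (th * (s - j)%:R) = cis (- (th * j%:R)).
  by move=> js; rewrite thN// cisD2pi.
have cis_sj j : (j <= s)%N -> cos (th * (s - j)%:R) = cos (th * j%:R) /\
    sin (th * (s - j)%:R) = - sin (th * j%:R).
  by move=> js; have [-> ->] := cis_s _ js; rewrite cosN sinN.
have [cs0 ss0] := cis_sj 0%N (leq0n _).
rewrite subn0 mulr0 cos0 sin0 oppr0 in cs0 ss0.
have [cs1 ss1] : cos (th * (s - 1)%:R) = cos th /\ sin (th * (s - 1)%:R) = - sin th.
  by rewrite -{2 4}[th]mulr1; apply: cis_sj; rewrite sE; lia.
have [cs2 ss2] : cos (th * (s + 1)%:R) = cos th /\ sin (th * (s + 1)%:R) = sin th.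
  by rewrite natrD mulrDr mulr1 cosD sinD cs0 ss0; split; ring.
rewrite angle -/th digit_cfE.
rewrite (sum_symmetric_split (fun i => p i * cos (th * i%:R)) m1 sE).
rewrite (sum_symmetric_split (fun i => p i * sin (th * i%:R)) m1 sE) ms.
congr Complex.
  rewrite cs0 cs1 cs2 mulr0 !mulr1 cos0 th_half cospi; congr (_ + _); first by ring.
  apply: eq_big_nat => j jm; rewrite thj (cis_sj j _).1; last lia.
  by rewrite mulrDl.
rewrite ss0 ss1 ss2 mulr0 !mulr1 sin0 th_half sinpi; congr (_ + _); first by ring.
apply: eq_big_nat => j jm; rewrite thj (cis_sj j _).2; last lia.
by ring.
Qed.
End digit_cf_first_factor.

(** * Real-valued integrals of bounded functions and finite sums *)

Section Rintegral_facts.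
Context {d : measure_display} {T : measurableType d} {R : realType}.
Variable mu : {measure set T -> \bar R}.

Lemma integrable_norm_le (D : set T) (f : T -> R) (M : R) :
  measurable D -> (mu D < +oo)%E -> measurable_fun D f ->
  (forall x, `|f x| <= M) -> mu.-integrable D (EFin \o f).
Proof.
move=> mD Doo mf fM; apply: measurable_bounded_integrable => //.
exists M; split; first exact: num_real.
by move=> x Mx y _ /=; rewrite (le_trans (fM y))// ltW.
Qed.

Lemma integrable_RD (D : set T) (f g : T -> R) : measurable D ->
  mu.-integrable D (EFin \o f) -> mu.-integrable D (EFin \o g) ->
  mu.-integrable D (EFin \o (fun x => f x + g x)).
Proof. by move=> mD intf intg; exact: (integrableD mD intf intg). Qed.

Lemma integrable_RZ (D : set T) (r : R) (f : T -> R) : measurable D ->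
  mu.-integrable D (EFin \o f) -> mu.-integrable D (EFin \o (fun x => r * f x)).
Proof. by move=> mD intf; exact: (integrableZl mD r intf). Qed.

Lemma integrable_Rsum (D : set T) (I : Type) (r : seq I) (f : I -> T -> R) :
  measurable D -> (forall i, mu.-integrable D (EFin \o f i)) ->
  mu.-integrable D (EFin \o (fun x => \sum_(i <- r) f i x)).
Proof.
move=> mD intf.
rewrite (_ : _ \o _ = fun x => (\sum_(i <- r) (f i x)%:E)%E).
  exact: (@integrable_sum _ _ _ mu D mD I r xpredT (fun i => EFin \o f i) (fun i _ => intf i)).
by apply/funext => x; rewrite /= sumEFin.
Qed.

Lemma Rintegral_sum (D : set T) (I : Type) (r : seq I) (f : I -> T -> R) :
  measurable D -> (forall i, mu.-integrable D (EFin \o f i)) ->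
  \int[mu]_(x in D) (\sum_(i <- r) f i x) = \sum_(i <- r) \int[mu]_(x in D) f i x.
Proof.
move=> mD intf; rewrite /Rintegral.
under eq_integral do rewrite -sumEFin.
rewrite integral_sum// sum_fine// => i _.
exact: integrable_fin_num (intf i).
Qed.

End Rintegral_facts.

(** * Passage to the limit under an expectation *)

Section expectation_limits.
Context {d : measure_display} {T : measurableType d} {R : realType}.
Variable P : probability T R.

(** Dominated convergence with dominating function 1; it serves for [h] equal to [cos] or [sin]. *)
Lemma cvg_Rintegral_bounded (h : R -> R) (Y_ : nat -> T -> R) (Y : T -> R) :
  continuous h -> (forall x, `|h x| <= 1) ->
  (forall n, measurable_fun setT (Y_ n)) -> measurable_fun setT Y ->
  {ae P, forall w, Y_ ^~ w @ \oo --> Y w} ->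
  (\int[P]_w h (Y_ n w)) @[n --> \oo] --> \int[P]_w h (Y w).
Proof.
move=> ch h1 mY_ mY YY.
have mh : measurable_fun setT h by exact: continuous_measurable_fun.
have [] := @dominated_convergence _ _ _ P setT measurableT
  (fun n => EFin \o h \o Y_ n) (EFin \o h \o Y) (cst 1%E).
- by move=> n; do 2 apply: measurableT_comp => //.
- by do 2 apply: measurableT_comp => //.
- apply: filterS YY => w Yw _ /=.
  apply: cvg_EFin; first by exact: nearW.
  exact: (continuous_cvg _ (ch _)).
- exact: finite_measure_integrable_cst.
- by apply: aeW => w n _ /=; rewrite lee_fin.
move=> ihY _ cvgY; rewrite /Rintegral.
apply: fine_cvg; rewrite fineK//; exact: integrable_fin_num.
Qed.

End expectation_limits.

(** * Joint law of the first digits *)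

Section digits.
Context {d : measure_display} {T : measurableType d} {R : realType}.
Context {P : probability T R} (xi_ : nat -> {RV P >-> R}).
Context (N : nat) (p : nat -> R).
Hypothesis xi_indep : independent_RVs xi_.
Hypothesis xi_law : forall n i, (i < N)%N ->
  P (xi_ n @^-1` [set i%:R]) = (p i)%:E.
Hypothesis p_sum : \sum_(i < N) p i = 1.

Lemma measurable_RV_preimage (X : {RV P >-> R}) (B : set R) :
  measurable B -> measurable (X @^-1` B).
Proof. by move=> mB; rewrite -[X in measurable X]setTI; exact: measurable_funPT. Qed.

(** For each [j] the [N] events are disjoint and their probabilities add up to 1; there are only
    countably many [j]. *)
Lemma ae_digits :
  {ae P, forall w, forall j, exists i : 'I_N, xi_ j w = (i : nat)%:R}.
Proof.
apply: ae_foralln => j.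
pose A := \big[setU/set0]_(i < N) (xi_ j @^-1` [set (i : nat)%:R]).
have mA : measurable A.
  by apply: bigsetU_measurable => i _; exact: measurable_RV_preimage.
have PA : P A = 1%E.
  rewrite /A measure_semi_additive_ord//.
  - transitivity (\sum_(i < N) (p i)%:E)%E; last by rewrite sumEFin p_sum.
    by apply: eq_bigr => i _; exact: xi_law.
  - move=> i k _ _ [w [/= wi wk]]; apply/val_inj/eqP.
    by rewrite -(eqr_nat R) -wi -wk.
exists (~` A); split; first exact: measurableC.
  by have := probability_setC P mA; rewrite PA subee.
move=> w; apply: contra_not; rewrite /A => Aw.
move: Aw; rewrite -(bigcup_mkord N (fun i => xi_ j @^-1` [set i%:R])).
by move=> [i /= iN wi]; exists (Ordinal iN).
Qed.

Let digit_event n (a : {ffun 'I_n -> 'I_N}) : set T :=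
  [set w | forall j : 'I_n, xi_ j w = (a j : nat)%:R].

(** Puts the cylinder into the form used by [independent_RVs]: a finite set of indices, and a Borel
    set for every natural number, with [setT] as default from [n] on. *)
Let digit_eventE n (a : {ffun 'I_n -> 'I_N}) :
  let B := fun j => if insub j is Some i then [set (a i : nat)%:R : R] else setT in
  digit_event a = \bigcap_(j in [set` [fset k in iota 0 n]%fset]) (xi_ j @^-1` B j).
Proof.
move=> B; apply/seteqP; split => [w wa j /=|w wB j].
  rewrite !inE mem_iota /= add0n => jn; rewrite /B.
  by case: insubP => [i _ <-|//]; exact: wa.
have /= := wB (j : nat); rewrite !inE mem_iota add0n ltn_ord => /(_ isT).
by rewrite /B valK.
Qed.

Let measurable_B n (a : {ffun 'I_n -> 'I_N}) j :
  measurable (if insub j is Some i then [set (a i : nat)%:R : R] else setT).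
Proof. by case: insubP. Qed.

Let measurable_digit_event n (a : {ffun 'I_n -> 'I_N}) :
  measurable (digit_event a).
Proof.
rewrite digit_eventE; apply: fin_bigcap_measurable; first exact: finite_fset.
by move=> j _; exact: measurable_RV_preimage.
Qed.

Let probability_digit_event n (a : {ffun 'I_n -> 'I_N}) :
  P (digit_event a) = (\prod_(j < n) p (a j))%:E.
Proof.
rewrite digit_eventE xi_indep; last exact: measurable_B.
have fi : perm_eq [fset k in iota 0 n]%fset (iota 0 n).
  by apply: uniq_perm; rewrite ?fset_uniq ?iota_uniq// => k; rewrite !inE.
rewrite (perm_big _ fi) /= -{1}(subn0 n) -/(index_iota 0 n) big_mkord -prodEFin.
by apply: eq_bigr => j _; rewrite valK xi_law.
Qed.

(** Almost surely [H] equals the simple function with value [G a] on the cylinder of [a], and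
    independence gives the probability of each cylinder. *)
Lemma Rintegral_digits n (H : T -> R) (G : {ffun 'I_n -> 'I_N} -> R) :
  measurable_fun setT H ->
  (forall w (a : {ffun 'I_n -> 'I_N}),
     (forall j : 'I_n, xi_ j w = (a j : nat)%:R) -> H w = G a) ->
  \int[P]_w H w = \sum_(a : {ffun 'I_n -> 'I_N}) (\prod_(j < n) p (a j)) * G a.
Proof.
move=> mH HG.
have int1 a : P.-integrable setT (EFin \o \1_(digit_event (n:=n) a)).
  exact: integrable_indic.
transitivity (\int[P]_w \sum_a (G a * \1_(digit_event (n:=n) a) w)).
  congr fine; apply: ae_eq_integral => //.
  - exact/measurable_EFinP.
  - apply/measurable_EFinP; apply: measurable_sum => a.
    by apply: measurable_funM => //; exact: measurable_indic.
  apply: filterS ae_digits => w /choice[b bP] _.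
  pose a := [ffun j : 'I_n => b j].
  have wa : digit_event a w by move=> j; rewrite ffunE.
  (* Distinct strings have disjoint cylinders, so only the string of [w] contributes. *)
  congr EFin; rewrite (bigD1 a)//= big1 ?addr0.
    by rewrite indicE mem_set// mulr1; exact: HG.
  move=> c ca; rewrite indicE memNset ?mulr0// => wc.
  move/eqP: ca; apply; apply/ffunP => j; apply/val_inj/eqP.
  by rewrite -(eqr_nat R) -(wc j) -(wa j).
rewrite Rintegral_sum//; last first.
  move=> a; apply: (@integrable_norm_le _ _ _ _ _ _ `|G a|) => //.
  - by apply: (@le_lt_trans _ _ 1%E); [exact: probability_le1 | exact: ltry].
  - by apply: measurable_funM => //; exact: measurable_indic.
  - move=> w; rewrite normrM ler_piMr// indicE; by case: (_ \in _); rewrite ?normr1 ?normr0.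
apply: eq_bigr => a _; rewrite RintegralZl// mulrC; congr (_ * _).
rewrite /Rintegral integral_indic// setIT.
exact: (congr1 fine (probability_digit_event a)).
Qed.

End digits.

(** * Partial products of the characteristic function *)

Section partial_cf.
Context {R : realType} (s N : nat) (p : nat -> R).
Hypothesis s_gt0 : (0 < s)%N.
Hypothesis p_sum : \sum_(i < N) p i = 1.

Definition partial_cf n (t : R) : R[i] :=
  \prod_(j < n) digit_cf N p (t * s%:R ^- j.+1).

Let s0 : s%:R != 0 :> R. Proof. by rewrite pnatr_eq0 -lt0n. Qed.

Lemma partial_cfD k n t :
  partial_cf (k + n) t = partial_cf k t * partial_cf n (t * s%:R ^- k).
Proof.
rewrite /partial_cf big_split_ord; congr (_ * _); apply: eq_bigr => j _ /=.
by rewrite -mulrA -invfM -exprD addnS addnC.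
Qed.

Lemma mulX_divX k j : (j < k)%N -> s%:R ^+ k * s%:R ^- j.+1 = (s ^ (k - j.+1))%:R :> R.
Proof. by move=> jk; rewrite natrX exprB ?unitfE. Qed.

(** For [j < k] the frequency [2 pi s^k q s^-(j+1)] is an integer multiple of [2 pi], so every
    factor is 1. *)
Lemma partial_cf_int k q : partial_cf k (2 * pi * (s ^ k * q)%:R) = 1.
Proof.
rewrite /partial_cf big1// => j _.
have -> : 2 * pi * (s ^ k * q)%:R * s%:R ^- j.+1 =
    2 * pi * (s ^ (k - j.+1) * q)%:R :> R.
  by rewrite !natrM -mulX_divX// natrX; ring.
exact: digit_cf2pi.
Qed.

(** The frequencies on the left are [2 pi s^(d-j-1) - 2 pi s^-(j+1)]; modulo [2 pi] they are
    opposite to those on the right, and a change of sign conjugates each factor. *)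
Lemma partial_cfBint d :
  partial_cf d (2 * pi * (s%:R ^+ d - 1)) = conjc (partial_cf d (2 * pi)).
Proof.
rewrite /partial_cf rmorph_prod; apply: eq_bigr => j _ /=.
rewrite -digit_cfN -[RHS](digit_cfD2pi _ _ _ (s ^ (d - j.+1))); congr digit_cf.
by rewrite -mulX_divX//; ring.
Qed.

End partial_cf.

(** * Continuity of characteristic functions, by real and imaginary parts *)

Section charfun_limit.
Context {d : measure_display} {T : measurableType d} {R : realType}.
Context {P : probability T R}.
Implicit Types (X : {RV P >-> R}) (t : R).

Lemma Re_charfun X t : complex.Re (charfun X t) = \int[P]_w cos (t * X w).
Proof. by rewrite /charfun unlock. Qed.

Lemma Im_charfun X t : complex.Im (charfun X t) = \int[P]_w sin (t * X w).
Proof. by rewrite /charfun unlock. Qed.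

Let measurable_scale X t : measurable_fun setT (fun w => t * X w).
Proof. exact: measurable_funM. Qed.

Lemma cvg_Re_charfun X (t_ : nat -> R) t : t_ @ \oo --> t ->
  complex.Re (charfun X (t_ n)) @[n --> \oo] --> complex.Re (charfun X t).
Proof.
move=> tt; rewrite Re_charfun; under eq_fun do rewrite Re_charfun.
apply: (@cvg_Rintegral_bounded _ _ _ _ cos) => //.
- exact: continuous_cos.
- exact: cos_max.
- by apply: aeW => w; apply: cvgMl.
Qed.

Lemma cvg_Im_charfun X (t_ : nat -> R) t : t_ @ \oo --> t ->
  complex.Im (charfun X (t_ n)) @[n --> \oo] --> complex.Im (charfun X t).
Proof.
move=> tt; rewrite Im_charfun; under eq_fun do rewrite Im_charfun.
apply: (@cvg_Rintegral_bounded _ _ _ _ sin) => //.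
- exact: continuous_sin.
- exact: sin_max.
- by apply: aeW => w; apply: cvgMl.
Qed.

End charfun_limit.

(** * The infinite product and its self-similarity *)

Section charfun_digits.
Context {d : measure_display} {T : measurableType d} {R : realType}.
Context {P : probability T R} (xi_ : nat -> {RV P >-> R}) (xi : {RV P >-> R}).
Context (s N : nat) (p : nat -> R).
Hypothesis s_gt1 : (1 < s)%N.
Hypothesis xi_indep : independent_RVs xi_.
Hypothesis xi_law : forall n i, (i < N)%N ->
  P (xi_ n @^-1` [set i%:R]) = (p i)%:E.
Hypothesis p_sum : \sum_(i < N) p i = 1.
Hypothesis xi_def : {ae P, forall w,
  series (fun n => s%:R ^- n.+1 * xi_ n w) @ \oo --> xi w}.

Let W n w := series (fun n => s%:R ^- n.+1 * xi_ n w) n.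

Let measurable_W n : measurable_fun setT (W n).
Proof.
rewrite /W /series /=; apply: measurable_sum => j.
exact: measurable_funM.
Qed.

Let W_digits n t w (a : {ffun 'I_n -> 'I_N}) :
  (forall j : 'I_n, xi_ j w = (a j : nat)%:R) ->
  t * W n w = \sum_(j < n) t * s%:R ^- j.+1 * (a j)%:R.
Proof.
move=> wa; rewrite /W /series /= big_mkord mulr_sumr.
by apply: eq_bigr => j _; rewrite wa mulrA.
Qed.

Let measurable_tW n t : measurable_fun setT (fun w => t * W n w).
Proof. exact: measurable_funM. Qed.

(** The partial product is the characteristic function of the partial sum [W n], which tends to [xi]
    almost surely. *)
Lemma cvg_Re_partial_cf t :
  complex.Re (partial_cf s N p n t) @[n --> \oo] --> complex.Re (charfun xi t).
Proof.
rewrite Re_charfun.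
have -> : (fun n => complex.Re (partial_cf s N p n t)) =
    (fun n => \int[P]_w cos (t * W n w)).
  apply/funext => n; rewrite /partial_cf (prod_digit_cfE N p n (fun j => t * s%:R ^- j.+1)) /=.
  symmetry; apply: (Rintegral_digits xi_indep xi_law p_sum).
    apply: measurableT_comp => //; apply: continuous_measurable_fun.
    exact: continuous_cos.
  by move=> w a wa; rewrite (W_digits _ wa).
apply: (@cvg_Rintegral_bounded _ _ _ _ cos) => //.
- exact: continuous_cos.
- exact: cos_max.
- exact: measurable_funM.
- by apply: filterS xi_def => w Ww; apply: cvgMr.
Qed.

Lemma cvg_Im_partial_cf t :
  complex.Im (partial_cf s N p n t) @[n --> \oo] --> complex.Im (charfun xi t).
Proof.
rewrite Im_charfun.
have -> : (fun n => complex.Im (partial_cf s N p n t)) =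
    (fun n => \int[P]_w sin (t * W n w)).
  apply/funext => n; rewrite /partial_cf (prod_digit_cfE N p n (fun j => t * s%:R ^- j.+1)) /=.
  symmetry; apply: (Rintegral_digits xi_indep xi_law p_sum).
    apply: measurableT_comp => //; apply: continuous_measurable_fun.
    exact: continuous_sin.
  by move=> w a wa; rewrite (W_digits _ wa).
apply: (@cvg_Rintegral_bounded _ _ _ _ sin) => //.
- exact: continuous_sin.
- exact: sin_max.
- exact: measurable_funM.
- by apply: filterS xi_def => w Ww; apply: cvgMr.
Qed.

(** Limit in [n] of [partial_cfD], taken separately in the real and imaginary parts. *)
Lemma charfun_factor k t :
  charfun xi t = partial_cf s N p k t * charfun xi (t * s%:R ^- k).
Proof.
set z := partial_cf s N p k t; set c := charfun xi (t * _).
have cvgRe := @cvg_Re_partial_cf (t * s%:R ^- k).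
have cvgIm := @cvg_Im_partial_cf (t * s%:R ^- k).
have ReM (x y : R[i]) : complex.Re (x * y) =
  complex.Re x * complex.Re y - complex.Im x * complex.Im y by case: x; case: y.
have ImM (x y : R[i]) : complex.Im (x * y) =
  complex.Re x * complex.Im y + complex.Im x * complex.Re y by case: x; case: y.
have ReE : complex.Re (charfun xi t) = complex.Re (z * c).
  have := @cvg_Re_partial_cf t; rewrite -(cvg_shiftn k) => /cvg_lim <-//.
  apply/cvg_lim => //; rewrite ReM.
  under eq_fun do rewrite addnC partial_cfD ReM.
  by apply: cvgB; apply: cvgMr.
have ImE : complex.Im (charfun xi t) = complex.Im (z * c).
  have := @cvg_Im_partial_cf t; rewrite -(cvg_shiftn k) => /cvg_lim <-//.
  apply/cvg_lim => //; rewrite ImM.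
  under eq_fun do rewrite addnC partial_cfD ImM.
  by apply: cvgD; apply: cvgMr.
by move: ReE ImE; case: (charfun xi t); case: (z * c) => ? ? ? ? /= -> ->.
Qed.

(** The first [k] factors are 1, and the remaining ones form the value at [2 pi q]. *)
Lemma charfun_scale k q :
  charfun xi (2 * pi * (s ^ k * q)%:R) = charfun xi (2 * pi * q%:R).
Proof.
have s0 : s%:R != 0 :> R by rewrite pnatr_eq0; lia.
rewrite (charfun_factor k) partial_cf_int ?(ltnW s_gt1)// mul1r; congr charfun.
by rewrite natrM natrX; field; rewrite expf_neq0.
Qed.

Lemma charfun_gap k :
  charfun xi (2 * pi * (s%:R ^+ k - 1)) =
  conjc (partial_cf s N p k (2 * pi)) * charfun xi (2 * pi * (1 - s%:R ^- k)).
Proof.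
have s0 : s%:R != 0 :> R by rewrite pnatr_eq0; lia.
rewrite (charfun_factor k) partial_cfBint ?(ltnW s_gt1)//; congr (_ * charfun _ _).
by field; rewrite expf_neq0.
Qed.

(** With [c] the value at [2 pi], the two factors in [charfun_gap] tend to [conj c], as partial
    products, and to [c], by continuity; the limit is [|c|^2]. *)
Lemma cvg_Re_charfun_gap :
  complex.Re (charfun xi (2 * pi * (s%:R ^+ k - 1))) @[k --> \oo] -->
  complex.Re (charfun xi (2 * pi)) ^+ 2 + complex.Im (charfun xi (2 * pi)) ^+ 2.
Proof.
have ReM (x y : R[i]) : complex.Re (conjc x * y) =
    complex.Re x * complex.Re y + complex.Im x * complex.Im y.
  by case: x; case: y => ? ? ? ? /=; rewrite mulNr opprK.
have t_cvg : (2 * pi * (1 - s%:R ^- k) : R) @[k --> \oo] --> (2 * pi : R).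
  rewrite -[X in _ --> X]mulr1; apply: cvgMr.
  rewrite -[X in _ --> X]subr0; apply: cvgB; first exact: cvg_cst.
  under eq_fun do rewrite -exprVn.
  by apply: cvg_expr; rewrite ger0_norm// invf_lt1 ?ltr0n ?ltr1n//; lia.
under eq_fun do rewrite charfun_gap ReM.
rewrite !expr2; apply: cvgD; apply: cvgM.
- exact: cvg_Re_partial_cf.
- exact: cvg_Re_charfun.
- exact: cvg_Im_partial_cf.
- exact: cvg_Im_charfun.
Qed.

(** As the powers [s^-n], [n >= 1], sum to [1 / (s - 1)], the angles stay in [[0, x]] with
    [x = t (N-1) / (s-1)]. Each partial product then has real part at least [cos x > 0], a bound
    that survives the limit. *)
Lemma Re_charfun_gt0 (t : R) :
  (forall i, (i < N)%N -> 0 <= p i) -> 0 <= t -> t * N.-1%:R / (s%:R - 1) < pi / 2 ->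
  0 < complex.Re (charfun xi t).
Proof.
move=> p_ge0 t0; set x := _ / _ => x2.
have s1 : 0 < s%:R - 1 :> R by rewrite subr_gt0 ltr1n.
have s0 : s%:R != 0 :> R by rewrite pnatr_eq0; lia.
have x0 : 0 <= x by rewrite divr_ge0 ?mulr_ge0// ltW.
have pi0 := pi_gt0 R.
apply: (@lt_le_trans _ _ (cos x)).
  by apply: cos_gt0_pihalf; rewrite x2 andbT (lt_le_trans _ x0)// oppr_lt0 divr_gt0.
have := cvg_Re_partial_cf (t := t) => h.
rewrite -(cvg_lim _ h)//; apply: limr_ge; first by apply/cvg_ex; eexists; exact: h.
apply: nearW => n; apply: (Re_prod_digit_cf_ge p_ge0 p_sum (w := fun j => t * s%:R ^- j.+1)).
- by move=> j; rewrite mulr_ge0// invr_ge0 exprn_ge0.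
- lra.
have -> : \sum_(j < n) t * s%:R ^- j.+1 * N.-1%:R = x * (1 - s%:R ^- n).
  elim: n => [|n IHn]; first by rewrite big_ord0 invr1 subrr mulr0.
  rewrite big_ord_recr /= IHn /x exprS; field.
  by rewrite s0 expf_neq0// (gt_eqF s1).
by rewrite ler_piMr// gerBl invr_ge0 exprn_ge0.
Qed.

End charfun_digits.

(** * Chebyshev's inequality and the Borel-Cantelli lemma *)

Section chebyshev.
Context {d : measure_display} {T : measurableType d} {R : realType}.
Variable mu : {measure set T -> \bar R}.

(** Markov's inequality: [e] times the indicator of the set is at most [g]. *)
Lemma le_measure_Rintegral (D : set T) (g : T -> R) (e : R) :
  measurable D -> mu.-integrable D (EFin \o g) -> measurable_fun setT g ->
  (forall x, 0 <= g x) -> 0 < e ->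
  (mu (D `&` [set x | (e <= g x)%R]) <= (e^-1 * \int[mu]_(x in D) g x)%:E)%E.
Proof.
move=> mD ig mg g0 e0.
have mE : measurable [set x | e <= g x].
  have -> : [set x | e <= g x] = setT `&` g @^-1` `[e, +oo[.
    by rewrite setTI; apply/seteqP; split => x /=; rewrite in_itv/= andbT.
  exact: mg.
rewrite setIC -integral_indic// -[leLHS]mul1e -(mulVf (lt0r_neq0 e0)) EFinM.
rewrite -muleA EFinM; apply: lee_wpmul2l; first by rewrite lee_fin invr_ge0 ltW.
rewrite /Rintegral fineK; last exact: integrable_fin_num ig.
rewrite -ge0_integralZl//; last 2 first.
- by apply/measurable_EFinP; apply: measurable_indic.
- by rewrite lee_fin ltW.
apply: ge0_le_integral => //.
- by move=> x _; rewrite mule_ge0// lee_fin// ltW.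
- apply/measurable_EFinP; apply: measurable_funM => //; exact: measurable_indic.
- by apply/measurable_EFinP; exact: measurable_funTS.
move=> x Dx; rewrite -EFinM lee_fin indicE.
have [|_] := boolP (x \in _); last by rewrite mulr0.
by rewrite inE /= mulr1.
Qed.

End chebyshev.

Section borel_cantelli.
Context {d : measure_display} {T : measurableType d} {R : realType}.
Variable mu : {measure set T -> \bar R}.

(** Borel-Cantelli, as the bounds sum to [M]; the bound at 0 forces [0 <= M]. *)
Lemma lim_sup_set_geometric0 (F : nat -> set T) (M : R) :
  (forall j, measurable (F j)) ->
  (forall j, (mu (F j) <= (M / (2 ^ j.+1)%:R)%:E)%E) -> mu (lim_sup_set F) = 0%E.
Proof.
move=> mF muF; apply: lim_sup_set_cvg0 => //.
have M0 : 0 <= M.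
  have := le_trans (measure_ge0 mu (F 0%N)) (muF 0%N).
  by rewrite lee_fin pmulr_lge0// invr_gt0 ltr0n expn_gt0.
apply: le_lt_trans (ltry M).
apply: le_trans (epsilon_trick0 xpredT M0).
exact: lee_nneseries.
Qed.

End borel_cantelli.

(** * Averages of exponentials and their second moments *)

Section trigonometric_average.
Context {R : realType}.
Variables (q : nat -> nat) (N : nat).
Hypothesis N_gt0 : (0 < N)%N.

Definition avg_cos (x : R) : R := N%:R^-1 * \sum_(k < N) cos (2 * pi * (q k)%:R * x).
Definition avg_sin (x : R) : R := N%:R^-1 * \sum_(k < N) sin (2 * pi * (q k)%:R * x).
(* [|N^-1 \sum_(k < N) exp (2 i pi q_k x)|^2] *)
Definition sqnorm_avg (x : R) : R := avg_cos x ^+ 2 + avg_sin x ^+ 2.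

(** By the cosine of a difference; second moments thereby reduce to integrals at differences of
    frequencies. *)
Lemma sqnorm_avgE x : sqnorm_avg x = (N%:R ^- 2) *
  \sum_(k < N) \sum_(l < N) cos (2 * pi * ((q k)%:R - (q l)%:R) * x).
Proof.
rewrite /sqnorm_avg /avg_cos /avg_sin !exprMn -exprVn -mulrDr; congr (_ * _).
rewrite !expr2 !mulr_suml -big_split /=; apply: eq_bigr => k _.
rewrite !mulr_sumr -big_split /=; apply: eq_bigr => l _.
by rewrite -cosB; congr cos; ring.
Qed.

Let measurable_cosM a : measurable_fun setT (fun x : R => cos (a * x)).
Proof.
apply: measurableT_comp; last exact: measurable_funM.
by apply: continuous_measurable_fun; exact: continuous_cos.
Qed.

Let measurable_sinM a : measurable_fun setT (fun x : R => sin (a * x)).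
Proof.
apply: measurableT_comp; last exact: measurable_funM.
by apply: continuous_measurable_fun; exact: continuous_sin.
Qed.

Lemma measurable_avg_cos : measurable_fun setT avg_cos.
Proof. by apply: measurable_funM => //; apply: measurable_sum => k. Qed.

Lemma measurable_avg_sin : measurable_fun setT avg_sin.
Proof. by apply: measurable_funM => //; apply: measurable_sum => k. Qed.

Lemma measurable_sqnorm_avg : measurable_fun setT sqnorm_avg.
Proof.
apply: measurable_funD; apply: measurable_funX.
- exact: measurable_avg_cos.
- exact: measurable_avg_sin.
Qed.

Let avg_le1 (h : R -> R) (y : nat -> R) : (forall x, `|h x| <= 1) ->
  `|N%:R^-1 * \sum_(k < N) h (y k)| <= 1.
Proof.
move=> h1; rewrite normrM ger0_norm ?invr_ge0// ler_pdivrMl ?ltr0n// mulr1.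
apply: (le_trans (ler_norm_sum _ _ _)); apply: (@le_trans _ _ (\sum_(k < N) 1)).
  by apply: ler_sum.
by rewrite sumr_const card_ord.
Qed.

Lemma avg_cos_le1 x : `|avg_cos x| <= 1.
Proof. exact: (avg_le1 (fun k => 2 * pi * (q k)%:R * x) (@cos_max R)). Qed.

Lemma avg_sin_le1 x : `|avg_sin x| <= 1.
Proof. exact: (avg_le1 (fun k => 2 * pi * (q k)%:R * x) (@sin_max R)). Qed.

Lemma sqnorm_avg_ge0 x : 0 <= sqnorm_avg x.
Proof. by rewrite addr_ge0// sqr_ge0. Qed.

Lemma sqnorm_avg_le2 x : `|sqnorm_avg x| <= 2.
Proof.
rewrite ger0_norm ?sqnorm_avg_ge0//.
have := avg_cos_le1 x; have := avg_sin_le1 x; rewrite /sqnorm_avg !ler_norml.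
by move=> /andP[? ?] /andP[? ?]; nra.
Qed.

Context {d : measure_display} {T : measurableType d}.
Variables (mu : {measure set T -> \bar R}) (D : set T) (Y : T -> R).
Hypothesis mD : measurable D.
Hypothesis muD : (mu D < +oo)%E.
Hypothesis mY : measurable_fun setT Y.

Lemma integrable_cosM a : mu.-integrable D (EFin \o (fun x => cos (a * Y x))).
Proof.
apply: (@integrable_norm_le _ _ _ _ _ _ 1) => // [|x]; last exact: cos_max.
exact: measurable_funTS (measurableT_comp (measurable_cosM a) mY).
Qed.

Lemma integrable_sinM a : mu.-integrable D (EFin \o (fun x => sin (a * Y x))).
Proof.
apply: (@integrable_norm_le _ _ _ _ _ _ 1) => // [|x]; last exact: sin_max.
exact: measurable_funTS (measurableT_comp (measurable_sinM a) mY).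
Qed.

Lemma integrable_avg_cos : mu.-integrable D (EFin \o (avg_cos \o Y)).
Proof.
apply: (@integrable_norm_le _ _ _ _ _ _ 1) => // [|x]; last exact: avg_cos_le1.
exact: measurable_funTS (measurableT_comp measurable_avg_cos mY).
Qed.

Lemma integrable_avg_sin : mu.-integrable D (EFin \o (avg_sin \o Y)).
Proof.
apply: (@integrable_norm_le _ _ _ _ _ _ 1) => // [|x]; last exact: avg_sin_le1.
exact: measurable_funTS (measurableT_comp measurable_avg_sin mY).
Qed.

Lemma integrable_sqnorm_avg : mu.-integrable D (EFin \o (sqnorm_avg \o Y)).
Proof.
apply: (@integrable_norm_le _ _ _ _ _ _ 2) => // [|x]; last exact: sqnorm_avg_le2.
exact: measurable_funTS (measurableT_comp measurable_sqnorm_avg mY).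
Qed.

Lemma Rintegral_avg_cos : \int[mu]_(x in D) avg_cos (Y x) =
  N%:R^-1 * \sum_(k < N) \int[mu]_(x in D) cos (2 * pi * (q k)%:R * Y x).
Proof.
rewrite /avg_cos RintegralZl//; last first.
  exact: (@integrable_Rsum _ _ _ mu D _ (index_enum _)
    (fun (k : 'I_N) x => cos (2 * pi * (q k)%:R * Y x)) mD
    (fun k => integrable_cosM _)).
by rewrite Rintegral_sum// => k; exact: integrable_cosM.
Qed.

Lemma Rintegral_avg_sin : \int[mu]_(x in D) avg_sin (Y x) =
  N%:R^-1 * \sum_(k < N) \int[mu]_(x in D) sin (2 * pi * (q k)%:R * Y x).
Proof.
rewrite /avg_sin RintegralZl//; last first.
  exact: (@integrable_Rsum _ _ _ mu D _ (index_enum _)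
    (fun (k : 'I_N) x => sin (2 * pi * (q k)%:R * Y x)) mD
    (fun k => integrable_sinM _)).
by rewrite Rintegral_sum// => k; exact: integrable_sinM.
Qed.

(** Among the [N^2] terms of the expansion, [N] are diagonal and bounded by [Delta], the others by
    [M]. *)
Lemma Rintegral_sqnorm_avg_le (Delta M : R) : 0 <= M ->
  (forall k, \int[mu]_(x in D) cos (2 * pi * ((q k)%:R - (q k)%:R) * Y x) <= Delta) ->
  (forall k l, k != l ->
     \int[mu]_(x in D) cos (2 * pi * ((q k)%:R - (q l)%:R) * Y x) <= M) ->
  \int[mu]_(x in D) sqnorm_avg (Y x) <= Delta / N%:R + M.
Proof.
move=> M0 diag off; have N0 : 0 < N%:R :> R by rewrite ltr0n.
have icos k l := integrable_cosM (2 * pi * ((q k)%:R - (q l)%:R)).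
have isum k : mu.-integrable D (EFin \o (fun x =>
    \sum_(l < N) cos (2 * pi * ((q k)%:R - (q l)%:R) * Y x))).
  exact: (@integrable_Rsum _ _ _ mu D _ (index_enum _)
    (fun (l : 'I_N) x => cos (2 * pi * ((q k)%:R - (q l)%:R) * Y x)) mD
    (fun l => icos k l)).
have -> : \int[mu]_(x in D) sqnorm_avg (Y x) = N%:R ^- 2 *
    \sum_(k < N) \sum_(l < N)
      \int[mu]_(x in D) cos (2 * pi * ((q k)%:R - (q l)%:R) * Y x).
  under eq_Rintegral do rewrite sqnorm_avgE.
  rewrite RintegralZl//; last first.
    exact: (@integrable_Rsum _ _ _ mu D _ (index_enum _)
      (fun (k : 'I_N) x => \sum_(l < N)
         cos (2 * pi * ((q k)%:R - (q l)%:R) * Y x)) mD isum).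
  rewrite Rintegral_sum//; congr (_ * _); apply: eq_bigr => k _.
  by rewrite Rintegral_sum.
rewrite ler_pdivrMl ?exprn_gt0//.
have -> : N%:R ^+ 2 * (Delta / N%:R + M) = \sum_(k < N) (Delta + \sum_(l < N) M).
  by rewrite !sumr_const card_ord -(mulr_natl (_ + _)) -(mulr_natl M); field; rewrite gt_eqF.
apply: ler_sum => k _; rewrite (bigD1 k)//= lerD//.
(* The right-hand sum has an extra term [M] at [l = k], dropped because [0 <= M]. *)
rewrite [leRHS](bigD1 k)//= -[leLHS]add0r lerD//.
by apply: ler_sum => l lk; apply: off; rewrite eq_sym.
Qed.

End trigonometric_average.

(** * The averages under Lebesgue measure *)

Section lebesgue_average.
Context {R : realType}.
Local Notation mu := (@lebesgue_measure R).

(** The primitive [sin (r x) / r] vanishes at both ends. *)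
Lemma Rintegral_cos_segment (r K : R) : 0 < K -> r != 0 -> sin (r * K) = 0 ->
  \int[mu]_(x in `[- K, K]) cos (r * x) = 0.
Proof.
move=> K0 r0 sK.
pose F (x : R) := r^-1 * sin (r * x).
have dF (x : R) : is_derive x 1 F (cos (r * x)).
  have dg : is_derive x 1 (fun y : R => r * y) r.
    by have := @is_deriveZ _ _ _ _ r _ _ _ (is_derive_id x (1 : R)); rewrite scaler1.
  have := @is_deriveZ _ _ _ _ r^-1 _ _ _ (is_derive1_comp (is_derive_sin (r * x)) dg).
  by rewrite /GRing.scale /= mulrCA mulVf// mulr1.
have cF : continuous F.
  by move=> x; apply: differentiable_continuous; apply/derivable1_diffP; apply: ex_derive.
have ccos : continuous (fun x : R => cos (r * x)).
  move=> x; apply: continuous_comp; last exact: continuous_cos.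
  exact: mulrl_continuous.
rewrite /Rintegral (@continuous_FTC2 _ _ F).
- by rewrite /F mulrN sinN sK oppr0 mulr0 subee.
- by rewrite gtrN.
- exact: continuous_subspaceT.
- split.
  + by move=> x _; apply: ex_derive.
  + exact/cvg_at_right_filter/cF.
  + exact/cvg_at_left_filter/cF.
- by move=> x _; rewrite derive1E derive_val.
Qed.

(** Exponentials of distinct integer frequencies are orthogonal on [[-K, K]], [K] being an integer;
    only the diagonal remains, each term being the length [2 K]. *)
Lemma lebesgue_sqnorm_avg_le (q : nat -> nat) (N K : nat) (e : R) :
  (0 < N)%N -> injective q -> 0 < e ->
  (mu (`[(- K%:R)%R, K%:R%R] `&` [set x | (e <= sqnorm_avg q N x)%R]) <=
     (e^-1 * (2 * K%:R / N%:R))%:E)%E.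
Proof.
move=> N0 qinj e0.
have muK : mu `[- K%:R, K%:R] = (2 * K%:R)%:E.
  rewrite lebesgue_measure_itv /= lte_fin; case: ltP => h.
    by rewrite -EFinB; congr EFin; ring.
  by congr EFin; have := ler0n R K; lra.
have muoo : (mu `[(- K%:R)%R, K%:R%R] < +oo)%E by rewrite muK ltry.
pose leb : {measure set (measurableTypeR R) -> \bar R} := @lebesgue_measure R.
have mK : measurable (`[- K%:R, K%:R] : set R) by [].
apply: le_trans (le_measure_Rintegral _ _ _ _ e0) _ => //.
- exact: (@integrable_sqnorm_avg _ q _ N0 _ _ leb _ _ mK muoo (@measurable_id _ _ setT)).
- exact: measurable_sqnorm_avg.
- exact: sqnorm_avg_ge0.
rewrite lee_fin; apply: ler_wpM2l; first by rewrite invr_ge0 ltW.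
(* Orthogonality allows the off-diagonal bound 0. *)
rewrite -[leRHS]addr0.
apply: (@Rintegral_sqnorm_avg_le _ q _ N0 _ _ leb _ _ mK muoo
  (@measurable_id _ _ setT)) => //.
  move=> k; under eq_Rintegral do rewrite subrr mulr0 mul0r cos0.
  by rewrite Rintegral_cst// mul1r /= muK.
move=> k l kl.
have [->|K0] := posnP K.
  by rewrite oppr0 set_itv1 Rintegral_set1.
rewrite Rintegral_cos_segment ?ltr0n//.
  have qkl : (q k)%:R - (q l)%:R != 0 :> R.
    by rewrite subr_eq0 eqr_nat; apply: contra kl => /eqP/qinj ->.
  by rewrite !mulf_neq0// ?pnatr_eq0// gt_eqF// pi_gt0.
have sin_int n : sin (2 * pi * n%:R) = 0 :> R.
  by have [_] := cisD2pi (0 : R) n; rewrite add0r sin0.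
have -> : 2 * pi * ((q k)%:R - (q l)%:R) * K%:R =
    2 * pi * (q k * K)%:R - 2 * pi * (q l * K)%:R :> R by rewrite !natrM; ring.
by rewrite sinB !sin_int mul0r mulr0 subrr.
Qed.

End lebesgue_average.

(** * A criterion for singularity *)

Section criterion.
Context {d : measure_display} {T : measurableType d} {R : realType}.
Context {P : probability T R} (X : {RV P >-> R}) (c : R[i]).
Let a := complex.Re c.
Let b := complex.Im c.
Let rho := a ^+ 2 + b ^+ 2.

(** Let [Z] be the average of the exponentials at [X]. Its mean is [c] and its second moment at most
    [1/N + rho + e], so [|Z - c|^2] has mean at most [1/N + e]; Markov's inequality at level
    [rho / 4] concludes. *)
Lemma probability_sqnorm_avg_lt (q : nat -> nat) (N : nat) (e : R) :
  (0 < N)%N -> 0 < rho -> 0 <= e ->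
  (forall k, charfun X (2 * pi * (q k)%:R) = c) ->
  (forall k l, k != l ->
     complex.Re (charfun X (2 * pi * ((q k)%:R - (q l)%:R))) <= rho + e) ->
  (P (X @^-1` (~` [set x | (rho / 4 <= sqnorm_avg q N x)%R])) <=
     (4 / rho * (N%:R^-1 + e))%:E)%E.
Proof.
move=> N0 rho0 e0 Xq Xqq.
have N0R : N%:R != 0 :> R by rewrite pnatr_eq0 -lt0n.
pose Q : {measure set T -> \bar R} := P.
have Qoo : (Q setT < +oo)%E.
  by apply: (@le_lt_trans _ _ 1%E); [exact: probability_le1 | exact: ltry].
have Q1 : fine (Q setT) = 1 by rewrite /Q /= probability_setT.
have mX : measurable_fun setT X by [].
have ipow : Q.-integrable setT (EFin \o (fun w => sqnorm_avg q N (X w))) :=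
  @integrable_sqnorm_avg _ q _ N0 _ _ Q _ _ measurableT Qoo mX.
have icos : Q.-integrable setT (EFin \o (fun w => avg_cos q N (X w))) :=
  @integrable_avg_cos _ q _ N0 _ _ Q _ _ measurableT Qoo mX.
have isin : Q.-integrable setT (EFin \o (fun w => avg_sin q N (X w))) :=
  @integrable_avg_sin _ q _ N0 _ _ Q _ _ measurableT Qoo mX.
(* This is [|Z - c|^2]. *)
pose g w := (avg_cos q N (X w) - a) ^+ 2 + (avg_sin q N (X w) - b) ^+ 2.
have gE : g = fun w => sqnorm_avg q N (X w) +
    ((- 2 * a) * avg_cos q N (X w) + ((- 2 * b) * avg_sin q N (X w) + rho)).
  by apply/funext => w; rewrite /g /sqnorm_avg /rho; ring.
have icst : Q.-integrable setT (EFin \o (fun=> rho)).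
  exact: finite_measure_integrable_cst.
have isin2 := integrable_RD measurableT (integrable_RZ (- 2 * b) measurableT isin) icst.
have icos2 := integrable_RD measurableT (integrable_RZ (- 2 * a) measurableT icos) isin2.
have ig := integrable_RD measurableT ipow icos2.
have mean_cos : \int[Q]_w avg_cos q N (X w) = a.
  rewrite (@Rintegral_avg_cos _ q N _ _ Q _ _ measurableT Qoo mX).
  under eq_bigr do rewrite -(Re_charfun X) Xq.
  by rewrite sumr_const card_ord -(mulr_natl (complex.Re c)) mulKf.
have mean_sin : \int[Q]_w avg_sin q N (X w) = b.
  rewrite (@Rintegral_avg_sin _ q N _ _ Q _ _ measurableT Qoo mX).
  under eq_bigr do rewrite -(Im_charfun X) Xq.
  by rewrite sumr_const card_ord -(mulr_natl (complex.Im c)) mulKf.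
have mean_sqnorm_avg : \int[Q]_w sqnorm_avg q N (X w) <= N%:R^-1 + (rho + e).
  rewrite -[N%:R^-1]mul1r.
  apply: (@Rintegral_sqnorm_avg_le _ q _ N0 _ _ Q _ _ measurableT Qoo mX).
  - by rewrite addr_ge0// ltW.
  - move=> k; under eq_Rintegral do rewrite subrr mulr0 mul0r cos0.
    by rewrite Rintegral_cst// mul1r Q1.
  - by move=> k l kl; rewrite -(Re_charfun X); exact: Xqq.
have int_g : \int[Q]_w g w <= N%:R^-1 + e.
  rewrite gE (RintegralD measurableT ipow icos2).
  rewrite (RintegralD measurableT (integrable_RZ _ measurableT icos) isin2).
  rewrite (RintegralD measurableT (integrable_RZ _ measurableT isin) icst).
  rewrite (RintegralZl _ measurableT icos) (RintegralZl _ measurableT isin).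
  rewrite Rintegral_cst// mean_cos mean_sin Q1.
  move: mean_sqnorm_avg; rewrite /rho; lra.
have mg : measurable_fun setT g.
  have mc := measurableT_comp (@measurable_avg_cos R q N) mX.
  have ms := measurableT_comp (@measurable_avg_sin R q N) mX.
  by apply: measurable_funD; apply: measurable_funX; exact: measurable_funB.
have g0 w : 0 <= g w by rewrite addr_ge0// sqr_ge0.
rewrite -gE in ig.
have rho4 : 0 < rho / 4 by rewrite divr_gt0.
have := le_measure_Rintegral measurableT ig mg g0 rho4.
rewrite setTI => chebyshev.
apply: le_trans (le_trans chebyshev _); last first.
  by rewrite lee_fin invf_div ler_wpM2l// ltW// divr_gt0.
apply: le_measure; rewrite ?inE.
- apply: measurable_RV_preimage; apply: measurableC.
  rewrite -[X in measurable X]setTI.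
  by apply: measurable_fun_le => //; exact: measurable_sqnorm_avg.
- rewrite -[X in measurable X]setTI.
  by apply: measurable_fun_le.
move=> w /= /negP; rewrite -ltNge => pw.
(* [|z|^2 < rho / 4] forces [|z - c|^2 > rho / 4], as [|c|^2 = rho]. *)
have := sqr_ge0 (2 * avg_cos q N (X w) - a).
have := sqr_ge0 (2 * avg_sin q N (X w) - b).
move: pw; rewrite /sqnorm_avg /g /rho => ? ? ?; lra.
Qed.

(** The carrier is the set of points lying in infinitely many [A j]. Averaging [2^(j+1)] terms makes
    summable both the Lebesgue measure of [A j] within a segment and the probability that [X] misses
    [A j]. *)
Lemma singular_criterion (q : nat -> nat -> nat) :
  0 < rho -> (forall j, injective (q j)) ->
  (forall j k, charfun X (2 * pi * (q j k)%:R) = c) ->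
  (forall j k l, k != l ->
     complex.Re (charfun X (2 * pi * ((q j k)%:R - (q j l)%:R)))
       <= rho + (2 ^ j.+1)%:R^-1) ->
  singular_distribution X.
Proof.
move=> rho0 qinj Xq Xqq.
have rho4 : 0 < rho / 4 by rewrite divr_gt0.
have N0 j : (0 < 2 ^ j.+1)%N by rewrite expn_gt0.
pose A j := [set x : R | rho / 4 <= sqnorm_avg (q j) (2 ^ j.+1) x].
have mA j : measurable (A j).
  rewrite -[X in measurable X]setTI.
  by apply: measurable_fun_le => //; exact: measurable_sqnorm_avg.
have mB : measurable (lim_sup_set A).
  by apply: bigcap_measurable => // n _; apply: bigcup_measurable => k _.
exists (lim_sup_set A); split => //.
  apply/negligibleP => //.
  (* Each [A j] is invariant under integer translations, so a finite nonzero measure is impossible: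
     the estimates are made on segments exhausting the line. *)
  pose seg (K : nat) : set R := `[- K%:R, K%:R]%classic.
  have mseg K : measurable (seg K) by exact: measurable_itv.
  have segA K : lebesgue_measure (lim_sup_set (fun j => seg K `&` A j)) = 0%E.
    apply: (@lim_sup_set_geometric0 _ _ _ _ _ ((rho / 4)^-1 * (2 * K%:R))).
      by move=> j; apply: measurableI; [exact: mseg|exact: mA].
    move=> j; apply: le_trans (lebesgue_sqnorm_avg_le K (N0 j) (@qinj j) rho4) _.
    by rewrite lee_fin mulrA.
  have : lebesgue_measure.-negligible
      (\bigcup_K lim_sup_set (fun j => seg K `&` A j)).
    apply: negligible_bigcup => K; apply/negligibleP => //.
    apply: bigcap_measurable => // n _; apply: bigcup_measurable => k _.
    by apply: measurableI; [exact: mseg|exact: mA].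
    exact: segA.
  move=> seg0; apply: (negligibleS _ seg0) => x Ax.
  exists (Num.truncn `|x|).+1 => // n _.
  have [k nk Akx] := Ax n I; exists k => //; split => //.
  by rewrite /seg /= in_itv /= -ler_norml ltW// truncnS_gt.
have Pnull : P (lim_sup_set (fun j => X @^-1` (~` A j))) = 0%E.
  apply: (@lim_sup_set_geometric0 _ _ _ _ _ (4 / rho * 2)).
    by move=> j; apply: measurable_RV_preimage; exact: measurableC.
  move=> j; apply: le_trans (probability_sqnorm_avg_lt (N0 j) rho0 _ (Xq j) (Xqq j)) _.
    by rewrite invr_ge0.
  by rewrite lee_fin le_eqVlt; apply/orP; left; apply/eqP; ring.
have mXB : measurable (X @^-1` lim_sup_set A) by exact: measurable_RV_preimage.
have : P (~` (X @^-1` lim_sup_set A)) = 0%E.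
  apply: (@subset_measure0 _ _ _ P _ (lim_sup_set (fun j => X @^-1` (~` A j)))) => //.
  - exact: measurableC.
  - apply: bigcap_measurable => // n _; apply: bigcup_measurable => k _.
    by apply: measurable_RV_preimage; exact: measurableC.
  (* Outside the limsup, [X w] avoids every [A j] from some rank [n] on, hence infinitely many of
     them. *)
  move=> w /= /existsNP[n /not_implyP[_ nA]] k _.
  exists (maxn k n) => /=; first exact: leq_maxl.
  by move=> Aw; apply: nA; exists (maxn k n) => //=; exact: leq_maxr.
have -> := probability_setC P mXB.
have yfin : P (X @^-1` lim_sup_set A) \is a fin_num by exact: fin_num_measure.
rewrite /distribution /pushforward -(fineK yfin) -EFinB => -[/eqP].
by rewrite subr_eq0 => /eqP <-.
Qed.

End criterion.

(** * The limsup bound and singularity for digit series *)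

Section charfun_digits_singular.
Context {d : measure_display} {T : measurableType d} {R : realType}.
Context {P : probability T R} (xi_ : nat -> {RV P >-> R}) (xi : {RV P >-> R}).
Context (s N : nat) (p : nat -> R).
Hypothesis s_gt1 : (1 < s)%N.
Hypothesis xi_indep : independent_RVs xi_.
Hypothesis xi_law : forall n i, (i < N)%N ->
  P (xi_ n @^-1` [set i%:R]) = (p i)%:E.
Hypothesis p_sum : \sum_(i < N) p i = 1.
Hypothesis xi_def : {ae P, forall w,
  series (fun n => s%:R ^- n.+1 * xi_ n w) @ \oo --> xi w}.
Let c := charfun xi (2 * pi).

Let charfun_pow k : charfun xi (2 * pi * (s ^ k)%:R) = c.
Proof.
rewrite -[(s ^ k)%N]muln1.
by rewrite (charfun_scale s_gt1 xi_indep xi_law p_sum xi_def) mulr1.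
Qed.

(** The points [2 pi s^k] go to infinity and all give the value [c]. *)
Lemma le_charfun_limsup :
  ((Normc.normc c)%:E <= charfun_limsup xi)%E.
Proof.
apply/ereal_infP => _ [V [M _ MV] <-].
have s1 : 1 < s%:R :> R by rewrite ltr1n.
have [k Mk] : exists k, M < 2 * pi * (s ^ k)%:R.
  exists (Num.truncn `|M|).+1; apply: le_lt_trans (ler_norm M) _.
  apply: lt_le_trans (truncnS_gt _) _.
  rewrite -[leLHS]mul1r; apply: ler_pM => //.
    by have := pi_ge2 R; lra.
  by rewrite ler_nat ltnW// ltn_expl.
apply: ereal_sup_ubound; exists (2 * pi * (s ^ k)%:R); last by rewrite charfun_pow.
apply: MV => /=; apply: lt_le_trans Mk _; exact: ler_norm.
Qed.

Lemma charfun_digits_singular : c != 0 -> singular_distribution xi.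
Proof.
move=> c0.
set rho := complex.Re c ^+ 2 + complex.Im c ^+ 2.
have rho0 : 0 < rho.
  rewrite lt0r addr_ge0 ?sqr_ge0// andbT paddr_eq0 ?sqr_ge0// !sqrf_eq0.
  by apply: contra c0; case: (c) => ? ? /= /andP[/eqP -> /eqP ->].
have gap := cvg_Re_charfun_gap s_gt1 xi_indep xi_law p_sum xi_def.
have /choice[L LP] j : exists L : nat, forall k, (L <= k)%N ->
    complex.Re (charfun xi (2 * pi * (s%:R ^+ k - 1))) <= rho + (2 ^ j.+1)%:R^-1.
  have e0 : 0 < (2 ^ j.+1)%:R^-1 :> R by rewrite invr_gt0 ltr0n expn_gt0.
  have /cvgrPdist_le/(_ _ e0)[L _ LP] := gap.
  exists L => k Lk; have := LP k Lk; rewrite -/c -/rho ler_distlC => /andP[_].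
  by rewrite addrC.
(* The frequencies are powers of [s] with exponents spaced by [(L j).+1]; the successor keeps them
   distinct when [L j = 0]. *)
apply: (@singular_criterion _ _ _ _ _ c (fun j k => (s ^ (L j).+1) ^ k)%N) => //.
- move=> j k l /= /eqP; rewrite eqn_exp2l => [/eqP//|].
  by apply: leq_trans s_gt1 _; rewrite -{1}(expn1 s) leq_exp2l.
- by move=> j k /=; rewrite -expnM charfun_pow.
move=> j.
have gap_le k l : (l < k)%N -> complex.Re (charfun xi
    (2 * pi * (((s ^ (L j).+1) ^ k)%:R - ((s ^ (L j).+1) ^ l)%:R))) <=
    rho + (2 ^ j.+1)%:R^-1.
  move=> lk; set t := (X in charfun _ X).
  pose e := ((L j).+1 * (k - l))%N.
  (* Scale invariance removes the power of [s] in front; the gap [e] that remains is at least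
     [L j]. *)
  have -> : t = 2 * pi * (s ^ ((L j).+1 * l) * (s ^ e - 1))%:R.
    rewrite /t; congr (_ * _); rewrite -!expnM -natrB; last first.
      by rewrite leq_exp2l// leq_mul2l ltnW ?orbT.
    by rewrite mulnBr muln1 -expnD -mulnDr subnKC ?(ltnW lk).
  rewrite (charfun_scale s_gt1 xi_indep xi_law p_sum xi_def).
  rewrite natrB ?expn_gt0 ?(ltnW s_gt1)// natrX; apply: LP.
  by rewrite /e; nia.
move=> k l kl; have [lk|kl'|kl'] := ltngtP l k.
- exact: gap_le.
(* [cos] is even, so the roles of [k] and [l] can be exchanged. *)
- rewrite Re_charfun; under eq_Rintegral do rewrite -opprB mulrN mulNr cosN.
  by rewrite -Re_charfun; exact: gap_le.
- by rewrite kl' eqxx in kl.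
Qed.

End charfun_digits_singular.

(* [xi_ n] is the random variable with weight s^-(n+1): the family is indexed
   from 0 instead of 1. *)
Theorem theorem6 (R : realType) (d : measure_display) (T : measurableType d)
    (P : probability T R) (m s : nat) (p : nat -> R)
    (xi_ : nat -> {RV P >-> R}) (xi : {RV P >-> R}) (u v : R)
    (hm : (1 < m)%N) (hs : s = (2 * m + 2)%N)
    (p_ge0 : forall i, (i <= s + 1)%N -> 0 <= p i)
    (p_lt1 : forall i, (i <= s + 1)%N -> p i < 1)
    (p_sum : \sum_(0 <= i < s + 2) p i = 1)
    (xi_indep : independent_RVs xi_)
    (xi_law : forall n i, (i <= s + 1)%N ->
       P (xi_ n @^-1` [set i%:R]) = (p i)%:E)
    (xi_def : {ae P, forall w,
       series (fun n => s%:R ^- n.+1 * xi_ n w) @ \oo --> xi w})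
    (hu : u = (p 0%N + p s - p (s %/ 2)%N)
              + (p 1%N + p (s + 1)%N + p (s - 1)%N) * cos (2 * pi / s%:R)
              + \sum_(2 <= j < m.+1)
                  (p j + p (s - j)%N) * cos (pi * j%:R / (m + 1)%:R))
    (hv : v = (p 1%N + p (s + 1)%N - p (s - 1)%N) * sin (pi / (m + 1)%:R)
              + \sum_(2 <= j < m.+1)
                  (p j - p (s - j)%N) * sin (pi * j%:R / (m + 1)%:R)) :
  (u <> 0 \/ v <> 0 ->
     [/\ ((Normc.normc (charfun xi (2 * pi)))%:E <= charfun_limsup xi)%E,
         0 < Normc.normc (charfun xi (2 * pi)) &
         singular_distribution xi])
  /\ (u = 0 /\ v = 0 -> Normc.normc (charfun xi (2 * pi)) = 0).
Proof.
have s1 : (1 < s)%N by lia.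
have law n i : (i < s + 2)%N -> P (xi_ n @^-1` [set i%:R]) = (p i)%:E.
  by move=> i2; apply: xi_law; lia.
have p0 i : (i < s + 2)%N -> 0 <= p i by move=> i2; apply: p_ge0; lia.
rewrite big_mkord in p_sum.
have s0 : s%:R != 0 :> R by rewrite pnatr_eq0; lia.
have cE : charfun xi (2 * pi) = Complex u v * charfun xi (2 * pi / s%:R).
  rewrite (charfun_factor xi_indep law p_sum xi_def 1) expr1; congr (_ * _).
  by rewrite /partial_cf big_ord1 expr1 (digit_cf_uv p hm hs) -hu -hv.
split=> [uv|[u0 v0]]; last first.
  by rewrite cE u0 v0 mul0r Normc.normc0.
have Re_gt0 : 0 < complex.Re (charfun xi (2 * pi / s%:R)).
  apply: (Re_charfun_gt0 s1 xi_indep law p_sum xi_def p0).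
    by rewrite divr_ge0// mulr_ge0// pi_ge0.
  (* The angle bound [2 pi (s+1) / (s (s-1))] is below [pi / 2] when [4 (s+1) < s (s-1)], which
     holds for [s >= 6], that is for [m > 1]. *)
  have s6 : 6 <= s%:R :> R by rewrite (ler_nat _ 6); lia.
  have -> : (s + 2).-1%:R = s%:R + 1 :> R by rewrite addn2 /= -natr1.
  rewrite ltr_pdivrMr; last lra.
  have pi0 := pi_gt0 R.
  have -> : 2 * pi / s%:R * (s%:R + 1) = pi * (2 * (s%:R + 1) / s%:R) :> R by ring.
  rewrite -(mulrA pi) ltr_pM2l// ltr_pdivrMr; last lra.
  nra.
have c0 : charfun xi (2 * pi) != 0.
  rewrite cE mulf_neq0//.
    by apply/eqP => -[u0 v0]; case: uv; exact.
  by apply: contraTneq Re_gt0 => ->; rewrite ltxx.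
split.
- exact: (le_charfun_limsup s1 xi_indep law p_sum xi_def).
- rewrite lt0r; apply/andP; split.
    by apply: contra c0 => /eqP/Normc.eq0_normc ->.
  by rewrite /Normc.normc; case: (charfun _ _) => ? ?; exact: sqrtr_ge0.
- exact: (charfun_digits_singular s1 xi_indep law p_sum xi_def).
Qed.
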